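(* Let $A\subseteq\omega$ be infinite and suppose $A$ is c.e. relative to every infinite subset of $A$. Then every infinite subset of $A$ computes $A$ if and only if every infinite subset of $A$ which is $\Delta^0_2(A)$ computes $A$.
   Context: $\Delta^0_2(A)$ means computable from the Turing jump $A'$. *)

(* Defs.v *)
(* A small, self-contained model of oracle computability:
   unary partial recursive functions on nat (Kleene-style, with Cantor
   pairing to encode tuples), relativised to an oracle set X : nat -> Prop. *)
From Stdlib Require Import Arith Cantor.

Definition pr (x y : nat) : nat := Cantor.to_nat (x, y).
Definition unpr (n : nat) : nat * nat := Cantor.of_nat n.

Inductive code : Type :=
  | CZero : code
  | CSucc : code
  | CFst : code
  | CSnd : code
  | COracle : code
  | CComp : code -> code -> code
  | CPair : code -> code -> code
  | CRec : code -> code -> code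
  | CMu : code -> code.

Inductive eval (X : nat -> Prop) : code -> nat -> nat -> Prop :=
  | ev_zero x : eval X CZero x 0
  | ev_succ x : eval X CSucc x (S x)
  | ev_fst x : eval X CFst x (fst (unpr x))
  | ev_snd x : eval X CSnd x (snd (unpr x))
  | ev_oracle_in x : X x -> eval X COracle x 1
  | ev_oracle_out x : ~ X x -> eval X COracle x 0
  | ev_comp g h x y v : eval X h x y -> eval X g y v -> eval X (CComp g h) x v
  | ev_pair g h x a b : eval X g x a -> eval X h x b -> eval X (CPair g h) x (pr a b)
  | ev_rec0 g h p x v : unpr p = (x, 0) -> eval X g x v -> eval X (CRec g h) p v
  | ev_recS g h p x n r v : unpr p = (x, S n) -> eval X (CRec g h) (pr x n) r ->
      eval X h (pr x (pr n r)) v -> eval X (CRec g h) p v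
  | ev_mu g x n : eval X g (pr x n) 0 ->
      (forall m, m < n -> exists v, 0 < v /\ eval X g (pr x m) v) ->
      eval X (CMu g) x n.

Fixpoint encode (c : code) : nat :=
  match c with
  | CZero => pr 0 0
  | CSucc => pr 1 0
  | CFst => pr 2 0
  | CSnd => pr 3 0
  | COracle => pr 4 0
  | CComp g h => pr 5 (pr (encode g) (encode h))
  | CPair g h => pr 6 (pr (encode g) (encode h))
  | CRec g h => pr 7 (pr (encode g) (encode h))
  | CMu g => pr 8 (encode g)
  end.

Definition computes (X A : nat -> Prop) : Prop :=
  exists c : code, forall n, (A n -> eval X c n 1) /\ (~ A n -> eval X c n 0).

Definition ce_in (X A : nat -> Prop) : Prop :=
  exists c : code, forall n, A n <-> exists v, eval X c n v.

Definition jump (X : nat -> Prop) : nat -> Prop :=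
  fun n => exists c : code, encode c = n /\ exists v, eval X c n v.

Definition Delta02 (X B : nat -> Prop) : Prop := computes (jump X) B.

Definition infinite (A : nat -> Prop) : Prop := forall m, exists n, m <= n /\ A n.

Definition subset (B A : nat -> Prop) : Prop := forall n, B n -> A n.

(* Main.v *)
(* One infinite [C] inside [A], computable from the jump of [A], decides the
   nontrivial direction.  [C] is built by finite extensions inside [A]: at stage
   [c], if some extension makes the [c]-th functional reject a member of [A],
   take it.  By hypothesis [C] computes [A], say by [c]; then no extension of
   stage [c] ever rejects a member of [A], while initial segments of [C] reject
   every nonmember.  So the complement of [A] is the set of numbers rejected
   through some finite extension inside [A], which is c.e. in every [B] in which
   [A] is c.e.; for such [B] both [A] and its complement are c.e. in [B]. *)
From Stdlib Require Import Arith Lia List Cantor Classical ClassicalEpsilon.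
Require Import Defs.

(** * Pairing and its projections *)

Definition pi1 (n : nat) : nat := fst (unpr n).
Definition pi2 (n : nat) : nat := snd (unpr n).

Lemma unpr_pr x y : unpr (pr x y) = (x, y).
Proof. apply Cantor.cancel_of_to. Qed.

Lemma pi1_pr x y : pi1 (pr x y) = x.
Proof. unfold pi1. now rewrite unpr_pr. Qed.

Lemma pi2_pr x y : pi2 (pr x y) = y.
Proof. unfold pi2. now rewrite unpr_pr. Qed.

Lemma pr_pi n : pr (pi1 n) (pi2 n) = n.
Proof.
  unfold pr, pi1, pi2, unpr. rewrite <- surjective_pairing.
  apply Cantor.cancel_to_of.
Qed.

Lemma pr_inj x y x' y' : pr x y = pr x' y' -> x = x' /\ y = y'.
Proof.
  intro H. split.
  - now rewrite <- (pi1_pr x y), H, pi1_pr.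
  - now rewrite <- (pi2_pr x y), H, pi2_pr.
Qed.

Lemma pr_le x y : y + x <= pr x y.
Proof. apply Cantor.to_nat_non_decreasing. Qed.

Lemma pi1_le n : pi1 n <= n.
Proof. generalize (pr_le (pi1 n) (pi2 n)). rewrite pr_pi. lia. Qed.

Lemma pi2_le n : pi2 n <= n.
Proof. generalize (pr_le (pi1 n) (pi2 n)). rewrite pr_pi. lia. Qed.

Lemma unpr_eq p x y : unpr p = (x, y) -> x = pi1 p /\ y = pi2 p.
Proof. intro H. unfold pi1, pi2. now rewrite H. Qed.

Lemma unpr_pi p : unpr p = (pi1 p, pi2 p).
Proof. apply surjective_pairing. Qed.

Global Opaque pr unpr pi1 pi2.

Ltac pr_simpl := repeat (rewrite ?pi1_pr, ?pi2_pr in *; cbv beta in * ).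

(** * Induction on evaluations, determinism, injectivity of code numbers *)

Section EvalInduction.

Variables (X : nat -> Prop) (P : code -> nat -> nat -> Prop).
Hypothesis P_zero : forall x, P CZero x 0.
Hypothesis P_succ : forall x, P CSucc x (S x).
Hypothesis P_fst : forall x, P CFst x (pi1 x).
Hypothesis P_snd : forall x, P CSnd x (pi2 x).
Hypothesis P_in : forall x, X x -> P COracle x 1.
Hypothesis P_out : forall x, ~ X x -> P COracle x 0.
Hypothesis P_comp : forall g h x y v, P h x y -> P g y v -> P (CComp g h) x v.
Hypothesis P_pair :
  forall g h x a b, P g x a -> P h x b -> P (CPair g h) x (pr a b).
Hypothesis P_rec0 : forall g h p x v,
  unpr p = (x, 0) -> P g x v -> P (CRec g h) p v.
Hypothesis P_recS : forall g h p x n r v,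
  unpr p = (x, S n) -> P (CRec g h) (pr x n) r -> P h (pr x (pr n r)) v ->
  P (CRec g h) p v.
Hypothesis P_mu : forall g x n,
  P g (pr x n) 0 ->
  (forall m, m < n -> exists v, 0 < v /\ P g (pr x m) v) -> P (CMu g) x n.

(* The induction principle generated for [eval] has no induction hypothesis
   for the premise of [ev_mu] nested under [exists]. *)
Fixpoint eval_nested_ind c x v (H : eval X c x v) {struct H} : P c x v :=
  match H in eval _ c x v return P c x v with
  | ev_zero _ x => P_zero x
  | ev_succ _ x => P_succ x
  | ev_fst _ x => P_fst x
  | ev_snd _ x => P_snd x
  | ev_oracle_in _ x H => P_in x H
  | ev_oracle_out _ x H => P_out x H
  | ev_comp _ g h x y v H1 H2 =>
      P_comp g h x y v (eval_nested_ind _ _ _ H1) (eval_nested_ind _ _ _ H2)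
  | ev_pair _ g h x a b H1 H2 =>
      P_pair g h x a b (eval_nested_ind _ _ _ H1) (eval_nested_ind _ _ _ H2)
  | ev_rec0 _ g h p x v E H => P_rec0 g h p x v E (eval_nested_ind _ _ _ H)
  | ev_recS _ g h p x n r v E H1 H2 =>
      P_recS g h p x n r v E
        (eval_nested_ind _ _ _ H1) (eval_nested_ind _ _ _ H2)
  | ev_mu _ g x n H1 H2 =>
      P_mu g x n (eval_nested_ind _ _ _ H1)
        (fun m Hm =>
           match H2 m Hm with
           | ex_intro _ v (conj Hv He) =>
               ex_intro _ v (conj Hv (eval_nested_ind _ _ _ He))
           end)
  end.

End EvalInduction.

Lemma eval_functional X c x v v' : eval X c x v -> eval X c x v' -> v = v'.
Proof.
  intro H. revert v'.
  induction H using eval_nested_ind; intros v' H'; inversion H'; subst;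
    try tauto; try reflexivity.
  - apply IHeval0. rewrite (IHeval y0); auto.
  - f_equal; auto.
  - apply IHeval. congruence.
  - congruence.
  - congruence.
  - assert (E : (x0, S n0) = (x, S n)) by congruence. injection E as -> ->.
    apply IHeval0. rewrite (IHeval r0); auto.
  (* Of two different results of a search, the smaller would have both the value 0 and a positive
     value. *)
  - destruct (lt_eq_lt_dec n v') as [[l | e] | l]; auto.
    + match goal with K : forall m, m < v' -> exists v, _ |- _ =>
        destruct (K n l) as [w [Hw He]] end.
      specialize (IHeval _ He). lia.
    + match goal with K : forall m, m < n -> exists v, _ |- _ =>
        destruct (K v' l) as [w [Hw He]] end.
      match goal with K : eval X g (pr x v') 0 |- _ => specialize (He _ K) end.
      lia.
Qed.

Lemma encode_inj c d : encode c = encode d -> c = d.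
Proof.
  revert d. induction c; intros [] E; simpl in E;
    apply pr_inj in E; destruct E as [E1 E2]; try discriminate; auto;
    try (apply pr_inj in E2; destruct E2); f_equal; auto.
Qed.

(** * Computable functions and decidable predicates *)

Definition computable (X : nat -> Prop) (f : nat -> nat) : Prop :=
  exists c, forall x, eval X c x (f x).

Definition if0 (a b c : nat) : nat := match a with 0 => b | S _ => c end.

Section Computable.

Variable X : nat -> Prop.

Lemma computable_ext f g :
  (forall x, f x = g x) -> computable X f -> computable X g.
Proof. intros E [c H]. exists c. intro x. rewrite <- E. apply H. Qed.

Lemma computable_id : computable X (fun e => e).
Proof.
  exists (CPair CFst CSnd). intro x. rewrite <- (pr_pi x) at 2.
  constructor; constructor.
Qed.

Lemma computable_comp f g :
  computable X f -> computable X g -> computable X (fun e => f (g e)).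
Proof.
  intros [c H] [d K]. exists (CComp c d). intro x. econstructor; eauto.
Qed.

Lemma computable_S f : computable X f -> computable X (fun e => S (f e)).
Proof. apply computable_comp. exists CSucc. constructor. Qed.

Lemma computable_pi1 f : computable X f -> computable X (fun e => pi1 (f e)).
Proof. apply computable_comp. exists CFst. constructor. Qed.

Lemma computable_pi2 f : computable X f -> computable X (fun e => pi2 (f e)).
Proof. apply computable_comp. exists CSnd. constructor. Qed.

Lemma computable_const n : computable X (fun _ => n).
Proof.
  induction n.
  - exists CZero. constructor.
  - now apply (computable_S (fun _ => n)).
Qed.

Lemma computable_pr f g :
  computable X f -> computable X g -> computable X (fun e => pr (f e) (g e)).
Proof. intros [c H] [d K]. exists (CPair c d). intro. now constructor. Qed.

Lemma computable_rec g h b :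
  computable X g ->
  computable X (fun z => h (pi1 z) (pi1 (pi2 z)) (pi2 (pi2 z))) ->
  computable X b ->
  computable X (fun e => nat_rect (fun _ => nat) (g e) (h e) (b e)).
Proof.
  intros [cg Hg] [ch Hh] Hb.
  (* Induction needs the number of steps free of the parameter: [CRec] keeps [pi1 z] fixed and
     counts up to [pi2 z]; [b e] is substituted afterwards. *)
  cut (computable X
         (fun z => nat_rect (fun _ => nat) (g (pi1 z)) (h (pi1 z)) (pi2 z))).
  { intro H.
    apply computable_ext with (f := fun e => (fun z =>
      nat_rect (fun _ => nat) (g (pi1 z)) (h (pi1 z)) (pi2 z)) (pr e (b e))).
    - intro x. now pr_simpl.
    - apply (computable_comp _ _ H), computable_pr; auto using computable_id. }
  exists (CRec cg ch). intro z. rewrite <- (pr_pi z) at 1.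
  induction (pi2 z) as [|n IH]; simpl.
  - eapply ev_rec0; [apply unpr_pr | apply Hg].
  - eapply ev_recS; [apply unpr_pr | apply IH |].
    specialize (Hh (pr (pi1 z) (pr n
      (nat_rect (fun _ => nat) (g (pi1 z)) (h (pi1 z)) n)))).
    now pr_simpl.
Qed.

Lemma computable_if0 f g h :
  computable X f -> computable X g -> computable X h ->
  computable X (fun e => if0 (f e) (g e) (h e)).
Proof.
  intros Hf Hg Hh.
  apply computable_ext with (f := fun e =>
    nat_rect (fun _ => nat) (g e) (fun _ _ => h e) (f e)).
  - intro e. now destruct (f e).
  - apply (computable_rec g (fun e _ _ => h e)); auto.
    apply (computable_comp h); auto. apply computable_pi1, computable_id.
Qed.

Lemma computable_pred f : computable X f -> computable X (fun e => pred (f e)).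
Proof.
  intro Hf. apply computable_ext with (f := fun e =>
    nat_rect (fun _ => nat) 0 (fun n _ => n) (f e)).
  - intro e. now destruct (f e).
  - apply (computable_rec (fun _ => 0) (fun _ n _ => n)); auto.
    + apply computable_const.
    + apply computable_pi1, computable_pi2, computable_id.
Qed.

End Computable.

Ltac computable :=
  cbv beta;
  match goal with
  | |- computable _ (fun e => e) => apply computable_id
  | |- computable _ (fun _ => ?n) => apply computable_const
  | |- computable ?X pi1 => exact (computable_pi1 X _ (computable_id X))
  | |- computable ?X pi2 => exact (computable_pi2 X _ (computable_id X))
  | H : computable ?X ?f |- computable ?X ?f => exact H
  | |- computable _ (fun e => S (@?f e)) => apply (computable_S _ f); computable
  | |- computable _ (fun e => pi1 (@?f e)) =>
      apply (computable_pi1 _ f); computable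
  | |- computable _ (fun e => pi2 (@?f e)) =>
      apply (computable_pi2 _ f); computable
  | |- computable _ (fun e => pr (@?f e) (@?g e)) =>
      apply (computable_pr _ f g); computable
  | |- computable _ (fun e => if0 (@?f e) (@?g e) (@?h e)) =>
      apply (computable_if0 _ f g h); computable
  | |- computable _ (fun e => pred (@?f e)) =>
      apply (computable_pred _ f); computable
  | |- computable _ (fun e => nat_rect (fun _ => nat)
                       (@?g e) (fun n r => @?h e n r) (@?b e)) =>
      apply (computable_rec _ g h b); computable
  | H : computable ?X ?f |- computable ?X (fun e => ?f (@?g e)) =>
      apply (computable_comp _ f g H); computable
  | _ => idtac
  end.

Section Decidable.

Variable X : nat -> Prop.

(** Trades the two-valued code for a total function whose zeros are the members, the convention that
    [CMu] searches by. Excluded middle names the value that the code returns. *)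
Lemma computes_iff P :
  computes X P <-> exists f, computable X f /\ forall n, P n <-> f n = 0.
Proof.
  split.
  - intros [c H].
    exists (fun n => if0 (if excluded_middle_informative (P n) then 1 else 0) 1 0).
    split.
    + assert (Hf : computable X
        (fun n => if excluded_middle_informative (P n) then 1 else 0)).
      { exists c. intro n. specialize (H n).
        destruct (excluded_middle_informative (P n)); tauto. }
      apply (computable_comp _ (fun k => if0 k 1 0)); computable.
    + intro n. destruct (excluded_middle_informative (P n)); simpl; intuition lia.
  - intros [f [Hf H]].
    assert (K : computable X (fun n => if0 (f n) 1 0)) by computable.
    destruct K as [c K]. exists c. intro n. specialize (K n).
    destruct (f n) eqn:E; simpl in K; split; rewrite H; intro; auto; lia.
Qed.

Lemma computes_ext P Q :
  (forall n, P n <-> Q n) -> computes X P -> computes X Q.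
Proof.
  intros E [c H]. exists c. intro n. rewrite <- (E n). apply H.
Qed.

Lemma computes_subst P f :
  computes X P -> computable X f -> computes X (fun e => P (f e)).
Proof.
  rewrite !computes_iff. intros [g [Hg H]] Hf.
  exists (fun e => g (f e)). split; [computable | intro; apply H].
Qed.

Lemma computes_not P : computes X P -> computes X (fun e => ~ P e).
Proof.
  rewrite !computes_iff. intros [f [Hf H]].
  exists (fun e => if0 (f e) 1 0). split; [computable|].
  intro n. rewrite H. destruct (f n); simpl; intuition lia.
Qed.

Lemma computes_and P Q :
  computes X P -> computes X Q -> computes X (fun e => P e /\ Q e).
Proof.
  rewrite !computes_iff. intros [f [Hf H]] [g [Hg K]].
  exists (fun e => if0 (f e) (g e) 1). split; [computable|].
  intro n. rewrite H, K. destruct (f n); simpl; intuition lia.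
Qed.

Lemma computes_or P Q :
  computes X P -> computes X Q -> computes X (fun e => P e \/ Q e).
Proof.
  rewrite !computes_iff. intros [f [Hf H]] [g [Hg K]].
  exists (fun e => if0 (f e) 0 (g e)). split; [computable|].
  intro n. rewrite H, K. destruct (f n); simpl; intuition lia.
Qed.

Lemma computes_impl P Q :
  computes X P -> computes X Q -> computes X (fun e => P e -> Q e).
Proof.
  intros HP HQ. apply computes_ext with (P := fun e => ~ P e \/ Q e).
  - intro n. tauto.
  - apply computes_or; [apply computes_not|]; assumption.
Qed.

Lemma computes_le f g :
  computable X f -> computable X g -> computes X (fun e => f e <= g e).
Proof.
  intros Hf Hg. apply computes_iff.
  exists (fun e => nat_rect (fun _ => nat) (f e) (fun _ r => pred r) (g e)).
  split; [computable|]. intro n.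
  assert (E : forall a b,
    nat_rect (fun _ => nat) a (fun _ r => pred r) b = a - b)
    by (intros a b; induction b; simpl; lia).
  rewrite E. lia.
Qed.

Lemma computes_lt f g :
  computable X f -> computable X g -> computes X (fun e => f e < g e).
Proof. intros. apply (computes_le (fun e => S (f e))); computable. Qed.

Lemma computes_eq f g :
  computable X f -> computable X g -> computes X (fun e => f e = g e).
Proof.
  intros Hf Hg.
  apply computes_ext with (P := fun e => f e <= g e /\ g e <= f e).
  - intro. lia.
  - apply computes_and; apply computes_le; assumption.
Qed.

Lemma computes_all_lt P b :
  computable X b -> computes X (fun z => P (pi1 z) (pi2 z)) ->
  computes X (fun e => forall m, m < b e -> P e m).
Proof.
  rewrite !computes_iff. intros Hb [f [Hf H]].
  (* The accumulator is a failure flag: it is 0 as long as every [m] so far satisfies [P], and never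
     returns to 0 afterwards. *)
  exists (fun e => nat_rect (fun _ => nat) 0
            (fun m r => if0 r (f (pr e m)) 1) (b e)).
  split; [computable|].
  assert (K : forall e m, P e m <-> f (pr e m) = 0).
  { intros e m. rewrite <- H. now pr_simpl. }
  intro e. induction (b e) as [|n IH]; simpl.
  - split; auto. lia.
  - destruct (nat_rect _ _ _ n) as [|k]; simpl.
    + rewrite <- K. split; auto. intros HP m Hm.
      destruct (Nat.eq_dec m n) as [-> | ne]; auto. apply IH; auto. lia.
    + split; [|discriminate]. intro HP.
      enough (S k = 0) by discriminate. apply IH. auto.
Qed.

Lemma computes_ex_lt P b :
  computable X b -> computes X (fun z => P (pi1 z) (pi2 z)) ->
  (forall e m, P e m -> m < b e) ->
  computes X (fun e => exists m, P e m).
Proof.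
  intros Hb HP Hlt.
  apply computes_ext with (P := fun e => ~ forall m, m < b e -> ~ P e m).
  - intro e. split.
    + intro H. apply NNPP. intro K. apply H. intros m _ Hm. apply K. eauto.
    + intros [m Hm] K. apply (K m); eauto.
  - apply computes_not. apply (computes_all_lt (fun e m => ~ P e m)); auto.
    now apply computes_not.
Qed.

Lemma computable_choice P :
  computes X (fun z => P (pi1 z) (pi2 z)) ->
  (forall e, exists y, P e y) ->
  exists f, computable X f /\ forall e, P e (f e).
Proof.
  rewrite computes_iff. intros [g [[c Hc] H]] Hex.
  assert (K : forall e m, P e m <-> g (pr e m) = 0).
  { intros e m. rewrite <- H. now pr_simpl. }
  (* [CMu] returns the least witness, so the choice function has to be the least one too. *)
  assert (Hmin : forall e, { y | P e y /\ forall m, m < y -> ~ P e m }).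
  { intro e. apply constructive_indefinite_description.
    destruct (dec_inh_nat_subset_has_unique_least_element (P e))
      as [y [[Hy Hl] _]]; [intro; apply classic | apply Hex |].
    exists y. split; auto. intros m Hm Pm. specialize (Hl m Pm). lia. }
  exists (fun e => proj1_sig (Hmin e)). split.
  - exists (CMu c). intro e. destruct (Hmin e) as [y [Py Hy]]; simpl.
    constructor.
    + apply K in Py. rewrite <- Py. apply Hc.
    + intros m Hm. exists (g (pr e m)). split; [|apply Hc].
      specialize (Hy m Hm). rewrite K in Hy. lia.
  - intro e. now destruct (Hmin e).
Qed.

Lemma computes_oracle f : computable X f -> computes X (fun e => X (f e)).
Proof.
  intro H. apply (computes_subst X); auto. exists COracle. intro n.
  split; constructor; assumption.
Qed.

End Decidable.

Ltac decide_in :=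
  cbv beta;
  lazymatch goal with
  | |- computes _ (fun e => @?P e /\ @?Q e) =>
      apply (computes_and _ P Q); decide_in
  | |- computes _ (fun e => @?P e \/ @?Q e) =>
      apply (computes_or _ P Q); decide_in
  | |- computes _ (fun e => ~ @?P e) => apply (computes_not _ P); decide_in
  | |- computes _ (fun e => @?f e = @?g e) => apply (computes_eq _ f g); computable
  | |- computes _ (fun e => @?f e < @?g e) => apply (computes_lt _ f g); computable
  | |- computes _ (fun e => @?f e <= @?g e) => apply (computes_le _ f g); computable
  | |- computes _ (fun e => forall m, m < @?b e -> @?P e m) =>
      apply (computes_all_lt _ P b); [computable | decide_in]
  | |- computes _ (fun e => @?P e -> @?Q e) =>
      apply (computes_impl _ P Q); decide_in
  | |- computes ?X (fun e => ?X (@?f e)) => apply (computes_oracle X f); computable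
  | _ => idtac
  end.

(** * Finite sequences *)

(** A sequence is a nested pair, head in [pi1] and tail in [pi2]. No length is stored: every number
    codes an infinite sequence, and a length is supplied where one is needed. *)
Definition entry (L i : nat) : nat := pi1 (Nat.iter i pi2 L).

Lemma entry_le L i : entry L i <= L.
Proof.
  unfold entry. etransitivity; [apply pi1_le|].
  induction i; simpl; auto. etransitivity; [apply pi2_le | apply IHi].
Qed.

Lemma entry_code f n : exists L, forall i, i < n -> entry L i = f i.
Proof.
  revert f. induction n as [|n IH]; intro f.
  - exists 0. lia.
  - destruct (IH (fun i => f (S i))) as [L HL]. exists (pr (f 0) L).
    intros [|i] Hi; unfold entry.
    + simpl. apply pi1_pr.
    + rewrite Nat.iter_succ_r, pi2_pr. apply HL. lia.
Qed.

Lemma entry_choice (P : nat -> nat -> Prop) n :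
  (forall i, i < n -> exists y, P i y) ->
  exists L, forall i, i < n -> P i (entry L i).
Proof.
  intro H.
  destruct (entry_code (fun i => epsilon (inhabits 0) (P i)) n) as [L HL].
  exists L. intros i Hi. rewrite HL by assumption. apply epsilon_spec. auto.
Qed.

Lemma computable_entry X f g :
  computable X f -> computable X g -> computable X (fun e => entry (f e) (g e)).
Proof.
  intros Hf Hg. unfold entry. apply computable_pi1.
  apply (computable_rec X f (fun _ _ r => pi2 r) g); computable.
Qed.

(** * Certificates of computations *)

(* [c x v] is derivable by one rule of [eval] from triples in [H], with oracle
   graph [O]; codes are given by their numbers. *)
Definition rule (O : nat -> nat -> Prop) (H : nat -> nat -> nat -> Prop)
    (c x v : nat) : Prop :=
  (c = pr 0 0 /\ v = 0) \/ (c = pr 1 0 /\ v = S x) \/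
  (c = pr 2 0 /\ v = pi1 x) \/ (c = pr 3 0 /\ v = pi2 x) \/
  (c = pr 4 0 /\ O x v) \/
  (pi1 c = 5 /\ exists y, H (pi2 (pi2 c)) x y /\ H (pi1 (pi2 c)) y v) \/
  (pi1 c = 6 /\ H (pi1 (pi2 c)) x (pi1 v) /\ H (pi2 (pi2 c)) x (pi2 v)) \/
  (pi1 c = 7 /\ pi2 x = 0 /\ H (pi1 (pi2 c)) (pi1 x) v) \/
  (pi1 c = 7 /\ 0 < pi2 x /\ exists r,
     H c (pr (pi1 x) (pred (pi2 x))) r /\
     H (pi2 (pi2 c)) (pr (pi1 x) (pr (pred (pi2 x)) r)) v) \/
  (pi1 c = 8 /\ H (pi2 c) (pr x v) 0 /\
     forall m, m < v -> exists w, 0 < w /\ H (pi2 c) (pr x m) w).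

Lemma rule_mono (O O' : nat -> nat -> Prop) (H H' : nat -> nat -> nat -> Prop)
    c x v :
  (O x v -> O' x v) -> (forall c x v, H c x v -> H' c x v) ->
  rule O H c x v -> rule O' H' c x v.
Proof.
  intros HO HH. unfold rule.
  intros [K|[K|[K|[K|[K|[[E [y K]]|[K|[K|[[E [l [r K]]]|[E [K K']]]]]]]]]]];
    [tauto|tauto|tauto|tauto|tauto
    | do 5 right; left | do 6 right; left | do 7 right; left
    | do 8 right; left | do 9 right].
  - split; auto. exists y. intuition.
  - intuition.
  - intuition.
  - split; auto. split; auto. exists r. intuition.
  - split; auto. split; auto. intros m Hm.
    destruct (K' m Hm) as [w Hw]. exists w. intuition.
Qed.

Lemma rule_sound X O H c x v :
  (forall x v, O x v -> eval X COracle x v) ->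
  (forall c x v, H (encode c) x v -> eval X c x v) ->
  rule O H (encode c) x v -> eval X c x v.
Proof.
  intros HO HH K. unfold rule in K.
  repeat (destruct K as [K | K]); destruct K as [E K];
    destruct c; simpl in E; rewrite ?pi1_pr in E;
    try discriminate; try (apply pr_inj in E; destruct E; discriminate);
    simpl in K; repeat rewrite ?pi1_pr, ?pi2_pr in K.
  - subst. constructor.
  - subst. constructor.
  - subst. constructor.
  - subst. constructor.
  - auto.
  - destruct K as [y [K1 K2]]. econstructor; eauto.
  - destruct K. rewrite <- (pr_pi v). constructor; auto.
  - destruct K as [K1 K2]. eapply ev_rec0; [|apply HH, K2].
    rewrite unpr_pi. congruence.
  - destruct K as [K1 [r [K2 K3]]].
    eapply ev_recS with (n := pred (pi2 x)).
    + rewrite unpr_pi. f_equal. lia.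
    + apply HH. exact K2.
    + auto.
  - destruct K as [K1 K2]. constructor; auto.
    intros m Hm. destruct (K2 m Hm) as [w [Hw K]]. eauto.
Qed.

(** List form of a computation, newest triple first. Such lists can be concatenated, as the
    completeness proof requires; numeric certificates come from them by reversal. *)
Inductive derivation (O : nat -> nat -> Prop) : list nat -> Prop :=
  | derivation_nil : derivation O nil
  | derivation_cons l c x v :
      derivation O l -> rule O (fun c x v => In (pr c (pr x v)) l) c x v ->
      derivation O (pr c (pr x v) :: l).

Lemma derivation_app O l l' :
  derivation O l -> derivation O l' -> derivation O (l ++ l').
Proof.
  induction 1; simpl; auto. intro. constructor; auto.
  eapply rule_mono; [| | eassumption]; auto.
  intros. apply in_or_app. auto.
Qed.

(** Oracles are relations between query and answer, so that total sets and finite partial oracles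
    both fit into [rule]. *)
Definition graph (X : nat -> Prop) (x v : nat) : Prop :=
  (X x /\ v = 1) \/ (~ X x /\ v = 0).

Lemma derivation_complete X c x v :
  eval X c x v ->
  exists l, derivation (graph X) l /\ In (pr (encode c) (pr x v)) l.
Proof.
  assert (Hcons : forall l c x v, derivation (graph X) l ->
    rule (graph X) (fun c x v => In (pr c (pr x v)) l) (encode c) x v ->
    exists l, derivation (graph X) l /\ In (pr (encode c) (pr x v)) l).
  { intros l c' x' v' Hl Hr. exists (pr (encode c') (pr x' v') :: l).
    split; [now constructor | now left]. }
  intro H. induction H using eval_nested_ind.
  - apply Hcons with (l := nil); [constructor|]. unfold rule. tauto.
  - apply Hcons with (l := nil); [constructor|]. unfold rule. tauto.
  - apply Hcons with (l := nil); [constructor|]. unfold rule. tauto.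
  - apply Hcons with (l := nil); [constructor|]. unfold rule. tauto.
  - apply Hcons with (l := nil); [constructor|]. unfold rule, graph. tauto.
  - apply Hcons with (l := nil); [constructor|]. unfold rule, graph. tauto.
  - destruct IHeval as [l1 [D1 I1]], IHeval0 as [l2 [D2 I2]].
    apply Hcons with (l := l1 ++ l2); [now apply derivation_app|].
    do 5 right; left. simpl. repeat rewrite ?pi1_pr, ?pi2_pr.
    split; auto. exists y. rewrite !in_app_iff. auto.
  - destruct IHeval as [l1 [D1 I1]], IHeval0 as [l2 [D2 I2]].
    apply Hcons with (l := l1 ++ l2); [now apply derivation_app|].
    do 6 right; left. simpl. repeat rewrite ?pi1_pr, ?pi2_pr.
    rewrite !in_app_iff. auto.
  - destruct IHeval as [l1 [D1 I1]].
    apply unpr_eq in H as [-> E].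
    apply Hcons with (l := l1); auto.
    do 7 right; left. simpl. repeat rewrite ?pi1_pr, ?pi2_pr. auto.
  - destruct IHeval as [l1 [D1 I1]], IHeval0 as [l2 [D2 I2]].
    apply unpr_eq in H as [-> E].
    apply Hcons with (l := l1 ++ l2); [now apply derivation_app|].
    do 8 right; left. simpl. repeat rewrite ?pi1_pr, ?pi2_pr.
    rewrite <- E. simpl. split; auto. split; [lia|].
    exists r. rewrite !in_app_iff. auto.
  - destruct IHeval as [l1 [D1 I1]].
    (* The search consults [g] at each [m < n]; induction on the bound joins these finitely many
       derivations into one list. *)
    assert (Hall : exists l, derivation (graph X) l /\ forall m, m < n ->
      exists w, 0 < w /\ In (pr (encode g) (pr (pr x m) w)) l).
    { clear I1. revert H. generalize n. intro k.
      induction k as [|k IHk]; intro Hm.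
      - exists nil. split; [constructor | lia].
      - destruct IHk as [l [D I]]; [auto|].
        destruct (Hm k) as [w [Hw [l2 [D2 I2]]]]; [lia|].
        exists (l ++ l2). split; [now apply derivation_app|].
        intros m Hlt. destruct (Nat.eq_dec m k) as [-> | ne].
        + exists w. rewrite in_app_iff. auto.
        + destruct (I m) as [w' [Hw' I']]; [lia|].
          exists w'. rewrite in_app_iff. auto. }
    destruct Hall as [l2 [D2 I2]].
    apply Hcons with (l := l1 ++ l2); [now apply derivation_app|].
    do 9 right. simpl. repeat rewrite ?pi1_pr, ?pi2_pr.
    split; auto. rewrite in_app_iff. split; auto.
    intros m Hm. destruct (I2 m Hm) as [w [Hw I]].
    exists w. rewrite in_app_iff. auto.
Qed.

Definition earlier (L j c x v : nat) : Prop :=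
  exists k, k < j /\ entry L k = pr c (pr x v).

(* [w] codes a list of [pi1 w] triples, each following by a rule of [eval] from
   earlier ones. *)
Definition certifies (O : nat -> nat -> Prop) (w c x v : nat) : Prop :=
  (forall j, j < pi1 w ->
     rule O (earlier (pi2 w) j) (pi1 (entry (pi2 w) j))
       (pi1 (pi2 (entry (pi2 w) j))) (pi2 (pi2 (entry (pi2 w) j)))) /\
  earlier (pi2 w) (pi1 w) c x v.

(** A certificate may contain triples whose first component is the number of no code. They do no
    harm: a triple for a code is justified by triples for codes, so the induction is restricted to
    those. *)
Lemma certifies_sound X O w c x v :
  (forall x v, O x v -> eval X COracle x v) ->
  certifies O w (encode c) x v -> eval X c x v.
Proof.
  intros HO [Hr Ht].
  assert (K : forall j, j <= pi1 w -> forall c x v,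
    earlier (pi2 w) j (encode c) x v -> eval X c x v).
  { induction j as [|j IH]; intros Hj d y u [k [Hk E]]; [lia|].
    specialize (Hr k). rewrite E in Hr. repeat rewrite ?pi1_pr, ?pi2_pr in Hr.
    eapply rule_sound; [apply HO | | apply Hr; lia].
    intros c' x' v' [k' [Hk' E']]. apply IH; [lia|].
    exists k'. split; auto. lia. }
  eapply K; [|apply Ht]. lia.
Qed.

(* The use principle: a certificate [w] only consults the oracle below [S w]. *)
Lemma certifies_mono (O O' : nat -> nat -> Prop) w c x v :
  (forall x v, x <= w -> O x v -> O' x v) ->
  certifies O w c x v -> certifies O' w c x v.
Proof.
  intros HO [Hr Ht]. split; auto. intros j Hj.
  eapply rule_mono; [| | apply (Hr j Hj)]; auto.
  apply HO. etransitivity; [apply pi1_le|]. etransitivity; [apply pi2_le|].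
  etransitivity; [apply entry_le|]. apply pi2_le.
Qed.

Lemma derivation_certifies O l c x v :
  derivation O l -> In (pr c (pr x v)) l -> exists w, certifies O w c x v.
Proof.
  intros D I.
  (* Reversal, because [derivation] adds at the head whereas an entry of a certificate refers to
     smaller indices. *)
  destruct (entry_code (fun i => nth i (rev l) 0) (length l)) as [L HL].
  assert (Hin : forall c x v, In (pr c (pr x v)) l ->
    earlier L (length l) c x v).
  { intros c' x' v' I'. rewrite in_rev in I'.
    apply In_nth with (d := 0) in I'. destruct I' as [k [Hk E]].
    rewrite length_rev in Hk. exists k. rewrite HL; auto. }
  exists (pr (length l) L). unfold certifies. rewrite pi1_pr, pi2_pr.
  split; auto. clear I Hin.
  induction D as [|l c' x' v' D IH Hr]; simpl; [lia|]. intros j Hj.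
  simpl in HL.
  assert (HL' : forall i, i < length l -> entry L i = nth i (rev l) 0).
  { intros i Hi. rewrite HL by lia. apply app_nth1. now rewrite length_rev. }
  destruct (Nat.eq_dec j (length l)) as [-> | ne]; [|apply IH; auto; lia].
  rewrite HL by lia. rewrite app_nth2, length_rev, Nat.sub_diag
    by (rewrite length_rev; lia). simpl. repeat rewrite ?pi1_pr, ?pi2_pr.
  eapply rule_mono; [| | exact Hr]; auto.
  intros c1 x1 v1 I'. rewrite in_rev in I'.
  apply In_nth with (d := 0) in I'. destruct I' as [k [Hk E]].
  rewrite length_rev in Hk. exists k. rewrite HL'; auto.
Qed.

Lemma certifies_complete X c x v :
  eval X c x v -> exists w, certifies (graph X) w (encode c) x v.
Proof.
  intro H. destruct (derivation_complete _ _ _ _ H) as [l [D I]].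
  eapply derivation_certifies; eauto.
Qed.

Lemma graph_sound X x v : graph X x v -> eval X COracle x v.
Proof. intros [[H ->] | [H ->]]; now constructor. Qed.

(** * Decidability of certificates *)

Section DecideCertificates.

Variable X : nat -> Prop.

Lemma computes_earlier L j c x v :
  computable X L -> computable X j -> computable X c -> computable X x ->
  computable X v ->
  computes X (fun e => earlier (L e) (j e) (c e) (x e) (v e)).
Proof.
  intros. unfold earlier.
  apply computes_ex_lt with (b := j); [computable | | tauto].
  decide_in; apply computable_entry || idtac; computable.
Qed.

(** Bounds the existential quantifiers in [rule]: an intermediate value is the last component of an
    entry of [L], hence at most [L]. *)
Lemma earlier_le L j c x v : earlier L j c x v -> v < S L.
Proof.
  intros [k [_ E]]. generalize (entry_le L k) (pr_le c (pr x v)) (pr_le x v).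
  lia.
Qed.

(** A family of oracles, decidable uniformly in the parameter: the searches below vary the finite
    oracle itself. *)
Variable O : nat -> nat -> nat -> Prop.
Hypothesis HO : computes X (fun z => O (pi1 z) (pi1 (pi2 z)) (pi2 (pi2 z))).

Lemma computes_rule p L j c x v :
  computable X p -> computable X L -> computable X j -> computable X c ->
  computable X x -> computable X v ->
  computes X (fun e => rule (O (p e)) (earlier (L e) (j e)) (c e) (x e) (v e)).
Proof.
  intros Hp HL Hj Hc Hx Hv. unfold rule.
  decide_in; try (apply computes_earlier; computable).
  - eapply computes_ext;
      [| apply (computes_subst _ _ (fun e => pr (p e) (pr (x e) (v e))) HO);
         computable].
    intro e. cbv beta. now repeat rewrite ?pi1_pr, ?pi2_pr.
  - apply computes_ex_lt with (b := fun e => S (L e)); [computable | |].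
    + decide_in; apply computes_earlier; computable.
    + intros e m [H _]. eapply earlier_le, H.
  - apply computes_ex_lt with (b := fun e => S (L e)); [computable | |].
    + decide_in; apply computes_earlier; computable.
    + intros e m [H _]. eapply earlier_le, H.
  - apply (computes_ex_lt _ (fun z w => 0 < w /\ earlier (L (pi1 z)) (j (pi1 z))
      (pi2 (c (pi1 z))) (pr (x (pi1 z)) (pi2 z)) w) (fun z => S (L (pi1 z))));
      [computable | |].
    + decide_in; apply computes_earlier; computable.
    + intros e m [_ H]. eapply earlier_le, H.
Qed.

Lemma computes_certifies p w c x v :
  computable X p -> computable X w -> computable X c -> computable X x ->
  computable X v ->
  computes X (fun e => certifies (O (p e)) (w e) (c e) (x e) (v e)).
Proof.
  intros Hp Hw Hc Hx Hv. unfold certifies.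
  apply computes_and; [|apply computes_earlier; computable].
  apply (computes_all_lt _ (fun e j => rule (O (p e)) (earlier (pi2 (w e)) j)
    (pi1 (entry (pi2 (w e)) j)) (pi1 (pi2 (entry (pi2 (w e)) j)))
    (pi2 (pi2 (entry (pi2 (w e)) j))))); [computable|].
  assert (HE : computable X (fun z => entry (pi2 (w (pi1 z))) (pi2 z)))
    by (apply computable_entry; computable).
  apply computes_rule; computable.
Qed.

End DecideCertificates.

(** * Queries to the jump *)

(** A number is in the jump when the code it numbers halts on that very number. Composing with a
    constant code discards this input and puts a chosen one in its place. *)
Fixpoint const_code (n : nat) : code :=
  match n with 0 => CZero | S n => CComp CSucc (const_code n) end.

Lemma eval_const_code X n x : eval X (const_code n) x n.
Proof.
  induction n as [|n IH]; simpl; [constructor|].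
  econstructor; [apply IH | constructor].
Qed.

Lemma computable_encode_const X :
  computable X (fun n => encode (const_code n)).
Proof.
  apply computable_ext with (f := fun n => nat_rect (fun _ => nat) (pr 0 0)
    (fun _ r => pr 5 (pr (pr 1 0) r)) n).
  - intro n. induction n as [|n IH]; simpl; congruence.
  - computable.
Qed.

Lemma jump_decides_exists X P :
  computes X (fun z => P (pi1 z) (pi2 z)) ->
  computes (jump X) (fun p => exists y, P p y).
Proof.
  (* Negated because [CMu] stops at 0: [k] returns 0 exactly on witnesses. The code built from [k]
     ignores its input and searches for a witness, so its number is in the jump exactly if there is
     one. *)
  intro HP. apply computes_not in HP. destruct HP as [k Hk].
  set (q := fun p => encode (CComp (CMu k) (const_code p))).
  assert (Hq : computable (jump X) q).
  { unfold q; simpl. pose proof (computable_encode_const (jump X)).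
    apply computable_pr; [computable|]. apply computable_pr; computable. }
  apply computes_ext with (P := fun p => jump X (q p));
    [|now apply computes_oracle].
  assert (K0 : forall p m, P p m -> eval X k (pr p m) 0).
  { intros p m H. apply Hk. repeat rewrite ?pi1_pr, ?pi2_pr. tauto. }
  assert (K1 : forall p m, ~ P p m -> eval X k (pr p m) 1).
  { intros p m H. apply Hk. repeat rewrite ?pi1_pr, ?pi2_pr. tauto. }
  intro p. split.
  - intros [c [E [v H]]]. apply encode_inj in E. subst c.
    inversion H as [| | | | | | g h x y u H1 H2 | | | |]; subst.
    rewrite (eval_functional _ _ _ _ _ H1 (eval_const_code X p _)) in H2.
    inversion H2; subst. exists v. apply NNPP. intro N.
    generalize (eval_functional _ _ _ _ _ (K1 _ _ N) H3). discriminate.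
  - intros Hex.
    destruct (dec_inh_nat_subset_has_unique_least_element (P p))
      as [y [[Hy Hl] _]]; [intro; apply classic | assumption |].
    exists (CComp (CMu k) (const_code p)). split; auto. exists y.
    econstructor; [apply eval_const_code|]. constructor; auto.
    intros m Hm. exists 1. split; auto. apply K1.
    intro Pm. specialize (Hl m Pm). lia.
Qed.

Lemma jump_computes X P : computes X P -> computes (jump X) P.
Proof.
  intro H. apply computes_ext with (P := fun p => exists y : nat, P p).
  - intro n. split; [intros [_ K]; exact K | intro K; now exists 0].
  - apply (jump_decides_exists X (fun p _ => P p)).
    apply (computes_subst X P); [assumption | computable].
Qed.

(** * The generic subset *)

(* A number [s] codes the partial oracle of length [pi1 s] whose members are
   the [x < pi1 s] with [entry (pi2 s) x = 1]. *)
Definition finite_oracle (s x v : nat) : Prop :=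
  x < pi1 s /\
  ((entry (pi2 s) x = 1 /\ v = 1) \/ (entry (pi2 s) x <> 1 /\ v = 0)).

(* The last bit is required to be [1] so that iterated extensions define an
   infinite set. *)
Definition end_extends (s t : nat) : Prop :=
  pi1 s < pi1 t /\
  (forall x, x < pi1 s -> entry (pi2 t) x = entry (pi2 s) x) /\
  entry (pi2 t) (pred (pi1 t)) = 1.

(** Constrains the new bits only, so the condition makes sense over any [s], even one with members
    outside [A]. *)
Definition adds_from (A : nat -> Prop) (s t : nat) : Prop :=
  forall x, x < pi1 t -> pi1 s <= x -> entry (pi2 t) x = 1 -> A x.

Lemma end_extends_trans r s t :
  end_extends r s -> end_extends s t -> end_extends r t.
Proof.
  intros [H1 [H2 H3]] [K1 [K2 K3]]. split; [lia|]. split; auto.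
  intros x Hx. rewrite K2 by lia. auto.
Qed.

Lemma adds_from_trans A r s t :
  end_extends s t -> adds_from A r s -> adds_from A s t -> adds_from A r t.
Proof.
  intros [H [E _]] Hs Ht x Hx Hr Hm.
  destruct (le_lt_dec (pi1 s) x) as [l | l]; [now apply Ht|].
  apply Hs; auto. rewrite <- E; auto.
Qed.

Lemma extension_exists A s :
  infinite A -> exists t, end_extends s t /\ adds_from A s t.
Proof.
  intro HA. destruct (HA (pi1 s)) as [n [Hn An]].
  (* Copy [s], pad with zeros up to a member [n] of [A] beyond it, and end with a 1 at [n]. *)
  destruct (entry_code (fun x => if lt_dec x (pi1 s) then entry (pi2 s) x
                                 else if Nat.eq_dec x n then 1 else 0) (S n))
    as [L HL].
  exists (pr (S n) L). unfold end_extends, adds_from. rewrite pi1_pr, pi2_pr.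
  split; [split; [lia|split]|].
  - intros x Hx. rewrite HL by lia. now destruct (lt_dec x (pi1 s)).
  - simpl. rewrite HL by lia. destruct (lt_dec n (pi1 s)); [lia|].
    now destruct (Nat.eq_dec n n).
  - intros x Hx Hs. rewrite HL by lia. destruct (lt_dec x (pi1 s)); [lia|].
    now destruct (Nat.eq_dec x n) as [-> |].
Qed.

Lemma computes_finite_oracle X :
  computes X (fun z => finite_oracle (pi1 z) (pi1 (pi2 z)) (pi2 (pi2 z))).
Proof.
  unfold finite_oracle.
  assert (computable X (fun z => entry (pi2 (pi1 z)) (pi1 (pi2 z))))
    by (apply computable_entry; computable).
  decide_in.
Qed.

Lemma computes_end_extends X s t :
  computable X s -> computable X t ->
  computes X (fun e => end_extends (s e) (t e)).
Proof.
  intros Hs Ht. unfold end_extends.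
  decide_in; apply computable_entry; computable.
Qed.

Lemma computes_adds_from A s t :
  computable A s -> computable A t ->
  computes A (fun e => adds_from A (s e) (t e)).
Proof.
  intros Hs Ht. unfold adds_from.
  assert (computable A (fun z => entry (pi2 (t (pi1 z))) (pi2 z)))
    by (apply computable_entry; computable).
  decide_in.
Qed.

(** Whether some extension inside [A] comes with a certified rejection of a member of [A] is an
    existential question about a relation decidable in [A], so the jump answers it. If yes, a search
    finds such an extension; if no, any extension will do, and the second disjunct records the
    answer. *)
Lemma generic_step A :
  infinite A ->
  exists f, computable (jump A) f /\ forall e s,
    end_extends s (f (pr e s)) /\ adds_from A s (f (pr e s)) /\
    ((exists n w, A n /\ certifies (finite_oracle (f (pr e s))) w e n 0) \/
     forall t n w, end_extends s t -> adds_from A s t ->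
       certifies (finite_oracle t) w e n 0 -> ~ A n).
Proof.
  intro HA.
  (* [p] pairs the index [e] with [s]; [y] codes an extension together with a pair of a rejected
     number and a certificate. *)
  set (ext := fun p y => end_extends (pi2 p) (pi1 y) /\
                         adds_from A (pi2 p) (pi1 y)).
  set (hit := fun p y => A (pi1 (pi2 y)) /\
    certifies (finite_oracle (pi1 y)) (pi2 (pi2 y)) (pi1 p) (pi1 (pi2 y)) 0).
  assert (Dext : computes A (fun z => ext (pi1 z) (pi2 z))).
  { unfold ext. apply computes_and;
      [apply computes_end_extends | apply computes_adds_from]; computable. }
  assert (Dhit : computes A (fun z => hit (pi1 z) (pi2 z))).
  { unfold hit. apply computes_and; [apply computes_oracle; computable|].
    apply (computes_certifies _ _ (computes_finite_oracle A)); computable. }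
  assert (Dboth : computes A
            (fun z => ext (pi1 z) (pi2 z) /\ hit (pi1 z) (pi2 z)))
    by now apply computes_and.
  pose proof (jump_decides_exists _ (fun p y => ext p y /\ hit p y) Dboth) as DE.
  destruct (computable_choice (jump A) (fun p y => ext p y /\
      (hit p y \/ ~ exists y, ext p y /\ hit p y))) as [f [Hf Hstep]].
  - apply computes_and; [now apply jump_computes|].
    apply computes_or; [now apply jump_computes|].
    apply (computes_subst _ (fun p => ~ exists y, ext p y /\ hit p y) pi1);
      [now apply computes_not | computable].
  - intro p. destruct (classic (exists y, ext p y /\ hit p y)) as [[y Hy] | N].
    + exists y. tauto.
    + destruct (extension_exists A (pi2 p) HA) as [t Ht].
      (* Without a hit only the extension matters; 0 fills the other place. *)
      exists (pr t 0). split; [|tauto]. unfold ext. now rewrite pi1_pr.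
  - exists (fun p => pi1 (f p)). split; [computable|].
    intros e s. destruct (Hstep (pr e s)) as [[H1 H2] H3].
    rewrite pi2_pr in H1, H2. split; [|split]; auto.
    destruct H3 as [[H3 H4] | N]; [left | right].
    + rewrite pi1_pr in H4. eauto.
    + intros t n w Ht1 Ht2 Hw An. apply N. exists (pr t (pr n w)).
      unfold ext, hit. repeat rewrite ?pi1_pr, ?pi2_pr. auto.
Qed.

(* If [C] decides [A] by [c], then no extension of a suitable finite part [s] of
   [C] lets [c] reject a member of [A], so the rejections witnessed by finite
   extensions of [s] inside [A] give exactly the complement of [A]. *)
Lemma generic_subset A :
  infinite A ->
  exists C, subset C A /\ infinite C /\ Delta02 A C /\
    forall c, (forall n, (A n -> eval C c n 1) /\ (~ A n -> eval C c n 0)) ->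
    exists s, forall n, ~ A n <->
      exists t w, end_extends s t /\ adds_from A s t /\
        certifies (finite_oracle t) w (encode c) n 0.
Proof.
  intro HA. destruct (generic_step A HA) as [f [Hf Hstep]].
  (* Stage 0 is the empty oracle; stage [S e] treats index [e]. *)
  set (st := nat_rect (fun _ => nat) (pr 0 0) (fun e s => f (pr e s))).
  assert (Dst : computable (jump A) st)
    by (apply (computable_rec _ (fun _ => pr 0 0) (fun _ e s => f (pr e s))
                 (fun k => k)); computable).
  assert (Hst : forall k, st (S k) = f (pr k (st k))) by reflexivity.
  assert (Hmono : forall k d, end_extends (st k) (st (S d + k)) /\
                              adds_from A (st k) (st (S d + k))).
  { intros k d. induction d as [|d [IH1 IH2]].
    - simpl plus. rewrite Hst.
      destruct (Hstep k (st k)) as [H1 [H2 _]]. auto.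
    - destruct (Hstep (S d + k) (st (S d + k))) as [H1 [H2 _]].
      rewrite <- Hst in H1, H2. change (S (S d) + k) with (S (S d + k)).
      split; [eapply end_extends_trans | eapply adds_from_trans]; eauto. }
  assert (Hlen : forall k, k <= pi1 (st k)).
  { induction k as [|k IH]; [lia|]. destruct (Hmono k 0) as [[H _] _].
    simpl plus in H. lia. }
  assert (Hagree : forall k l x, x < pi1 (st k) -> x < pi1 (st l) ->
            entry (pi2 (st k)) x = entry (pi2 (st l)) x).
  { assert (Hlt : forall k l x, k < l -> x < pi1 (st k) ->
              entry (pi2 (st l)) x = entry (pi2 (st k)) x).
    { intros k l x Hkl Hx. destruct (Hmono k (l - S k)) as [[_ [H _]] _].
      replace (S (l - S k) + k) with l in H by lia. auto. }
    intros k l x Hk Hl. destruct (lt_eq_lt_dec k l) as [[H | ->] | H]; auto.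
    symmetry. auto. }
  (* Stage [S x] has length at least [S x], so bit [x] is settled there, and later stages keep
     it. *)
  set (C := fun x => entry (pi2 (st (S x))) x = 1).
  assert (HC : forall k x, x < pi1 (st k) ->
            (C x <-> entry (pi2 (st k)) x = 1)).
  { intros k x Hx. unfold C. rewrite (Hagree (S x) k); [tauto | | auto].
    apply Hlen. }
  assert (HsC : forall k x v, finite_oracle (st k) x v -> eval C COracle x v).
  { intros k x v [Hx [[H ->] | [H ->]]]; constructor; now rewrite (HC k). }
  assert (HCs : forall k x v, x < k -> graph C x v -> finite_oracle (st k) x v).
  { intros k x v Hx H. specialize (Hlen k). assert (Hx' : x < pi1 (st k)) by lia.
    unfold graph in H. rewrite (HC k x Hx') in H. now split. }
  exists C. split; [|split; [|split]].
  - intros x Hx. destruct (Hmono 0 x) as [_ H]. rewrite Nat.add_0_r in H.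
    apply H; [apply Hlen | | exact Hx]. simpl. rewrite pi1_pr. lia.
  (* The last bit of stage [S m] is 1 and stands at position [m] or later, as the stage is at least
     [S m] long. *)
  - intro m. exists (pred (pi1 (st (S m)))).
    pose proof (Hlen (S m)). split; [lia|].
    apply (HC (S m)); [lia|]. destruct (Hmono m 0) as [[_ [_ H1]] _]. exact H1.
  - unfold Delta02, C.
    apply (computes_eq _ (fun x => entry (pi2 (st (S x))) x) (fun _ => 1));
      [apply computable_entry|]; computable.
  - intros c Hc. exists (st (encode c)).
    destruct (Hstep (encode c) (st (encode c)))
      as [_ [_ [[n [w [An Hw]]] | Hno]]].
    (* The next stage is part of [C], so the certified rejection is a true computation from [C],
       against the acceptance of the member [n]. *)
    + rewrite <- Hst in Hw. apply certifies_sound with (X := C) in Hw; [|apply HsC].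
      destruct (Hc n) as [H1 _].
      generalize (eval_functional _ _ _ _ _ Hw (H1 An)). discriminate.
    + intro n. split; [|intros [t [w [H1 [H2 H3]]]]; eauto].
      intro Nn. destruct (Hc n) as [_ H0].
      destruct (certifies_complete _ _ _ _ (H0 Nn)) as [w Hw].
      (* By the use principle [w] consults only arguments up to [w], where this stage agrees with
         [C]; adding [encode c] makes it also a later stage than [s]. *)
      exists (st (S w + encode c)), w.
      destruct (Hmono (encode c) w) as [H1 H2]. split; [|split]; auto.
      eapply certifies_mono; [|exact Hw]. intros x v Hx. apply HCs. lia.
Qed.

(** * Deciding [A] from enumerations of both sides *)

(** On input [n], search at once for an enumeration of [n] into [A] and for a rejecting extension.
    As [A] is so far only known to be c.e. in [B], it cannot be tested directly that an extension
    adds only members of [A]; the search therefore also guesses membership certificates for the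
    added numbers. *)
Lemma computes_from_enumerations A B s c :
  ce_in B A ->
  (forall n, ~ A n <-> exists t w, end_extends s t /\ adds_from A s t /\
     certifies (finite_oracle t) w c n 0) ->
  computes B A.
Proof.
  intros [a Ha] Hco.
  set (mem := fun n w => certifies (graph B) (pi1 w) (encode a) n (pi2 w)).
  assert (Hmem : forall n, A n <-> exists w, mem n w).
  { intro n. rewrite Ha. split.
    - intros [v H]. apply certifies_complete in H. destruct H as [w H].
      exists (pr w v). unfold mem. now rewrite pi1_pr, pi2_pr.
    - intros [w H]. exists (pi2 w). eapply certifies_sound; [|exact H].
      apply graph_sound. }
  assert (Dmem : forall f g, computable B f -> computable B g ->
            computes B (fun e => mem (f e) (g e))).
  { intros f g Hf Hg. unfold mem.
    apply (computes_certifies _ (fun _ => graph B)) with (p := fun _ => 0);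
      try computable.
    unfold graph. decide_in. }
  (* [y] codes an extension, a sequence of membership witnesses indexed by position, and a rejection
     certificate. *)
  set (nonmem := fun n y =>
    end_extends s (pi1 y) /\
    (forall x, x < pi1 (pi1 y) -> pi1 s <= x -> entry (pi2 (pi1 y)) x = 1 ->
       mem x (entry (pi1 (pi2 y)) x)) /\
    certifies (finite_oracle (pi1 y)) (pi2 (pi2 y)) c n 0).
  assert (Hnonmem : forall n, ~ A n <-> exists y, nonmem n y).
  { intro n. rewrite Hco. split.
    - intros [t [w [H1 [H2 H3]]]].
      destruct (entry_choice (fun x u => pi1 s <= x -> entry (pi2 t) x = 1 ->
                                mem x u) (pi1 t)) as [L HL].
      { intros x Hx. destruct (classic (A x)) as [Ax | Nx].
        - apply Hmem in Ax. destruct Ax as [u Hu]. eauto.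
        (* The extension never adds a number outside [A], so the default 0 is never tested. *)
        - exists 0. intros Hs Ht. now destruct (Nx (H2 x Hx Hs Ht)). }
      exists (pr t (pr L w)). unfold nonmem. repeat rewrite ?pi1_pr, ?pi2_pr.
      auto.
    - intros [y [H1 [H2 H3]]]. exists (pi1 y), (pi2 (pi2 y)).
      split; [|split]; auto. intros x Hx Hs Ht. apply Hmem. eauto. }
  destruct (computable_choice B (fun n y => mem n y \/ nonmem n y))
    as [f [Hf Hor]].
  - apply computes_or; [apply Dmem; computable|]. unfold nonmem.
    apply computes_and; [apply computes_end_extends; computable|].
    apply computes_and.
    + assert (computable B (fun z => entry (pi2 (pi1 (pi2 (pi1 z)))) (pi2 z)))
        by (apply computable_entry; computable).
      assert (computable B (fun z => entry (pi1 (pi2 (pi2 (pi1 z)))) (pi2 z)))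
        by (apply computable_entry; computable).
      decide_in. apply Dmem; computable.
    + apply (computes_certifies _ _ (computes_finite_oracle B)); computable.
  - intro n. destruct (classic (A n)) as [An | Nn].
    + apply Hmem in An. destruct An. eauto.
    + apply Hnonmem in Nn. destruct Nn. eauto.
  (* [f n] witnesses membership or nonmembership, and [B] can test whether it is the former. *)
  - apply computes_ext with (P := fun n => mem n (f n)).
    + intro n. split; [intro; apply Hmem; eauto|].
      intro An. destruct (Hor n) as [H | H]; auto.
      exfalso. cut (~ A n); [tauto|]. apply Hnonmem. eauto.
    + apply Dmem; computable.
Qed.

Theorem theorem3p3 (A : nat -> Prop) :
  infinite A ->
  (forall B : nat -> Prop, subset B A -> infinite B -> ce_in B A) ->
  ((forall B : nat -> Prop, subset B A -> infinite B -> computes B A) <->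
   (forall B : nat -> Prop, subset B A -> infinite B -> Delta02 A B -> computes B A)).
Proof.
  intros HA Hce. split; [auto|]. intros HD B HBA HB.
  destruct (generic_subset A HA) as [C [HCA [HC [DC Hgen]]]].
  destruct (HD C HCA HC DC) as [c Hc].
  (* The description of the complement through [s] does not mention [C], so it serves every [B]. *)
  destruct (Hgen c Hc) as [s Hs].
  exact (computes_from_enumerations A B s (encode c) (Hce B HBA HB) Hs).
Qed.
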